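(* Let $n$ be a positive integer. If $\mathbf{L}$ is an $n$-periodic $\ell$-pregroup that satisfies $\sigma_n(x)^n y\approx y\,\sigma_n(x)^n$, then the maps \[ \varphi\colon\mathcal{N}(\mathbf{L})\to\mathcal{N}(\mathbf{L}_g),\ H\mapsto H\cap L_g,\qquad \psi\colon\mathcal{N}(\mathbf{L}_g)\to\mathcal{N}(\mathbf{L}),\ G\mapsto \mathrm{N}_{\mathbf{L}}(G) \] form a pair of mutually inverse lattice isomorphisms. In particular, they are the restrictions of the mutually inverse lattice isomorphisms $H\mapsto H\cap L_g$ from $\mathcal{C}(\mathbf{L})$ to $\mathcal{C}(\mathbf{L}_g)$ and $K\mapsto\overline{K}$ from $\mathcal{C}(\mathbf{L}_g)$ to $\mathcal{C}(\mathbf{L})$, where $\overline{K}$ is the convex closure of $K$ in $\mathbf{L}$.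
   Context: An $\ell$-pregroup is an algebra $(A,\wedge,\vee,\cdot,1,{}^{\ell},{}^{r})$ such that $(A,\wedge,\vee)$ is a lattice, $(A,\cdot,1)$ is a monoid, multiplication is order-preserving in both arguments, and $a^{\ell}a\le 1\le aa^{\ell}$ and $aa^{r}\le 1\le a^{r}a$ for all $a\in A$. Write $x^{\ell^k}$, $x^{r^k}$ for the $k$-fold application of ${}^\ell$, ${}^r$. It is $n$-periodic if it satisfies $x^{\ell^n}\approx x^{r^n}$. For $k\ge 0$ let $x^{[k]}:=x^{\ell^{2k}}$, and $\sigma_n(x):=x\wedge x^{[1]}\wedge\dots\wedge x^{[n-1]}$. The group skeleton of $\mathbf{L}$ is the subalgebra $\mathbf{L}_g$ with universe $L_g=\{a\in L: a^\ell=a^r\}$; it is an $\ell$-group consisting of the invertible elements of $\mathbf{L}$. A subalgebra of an $\ell$-pregroup $\mathbf{M}$ is convex if it is convex in the lattice order, and normal if for every $a$ in it and every $b\in M$ it contains the conjugates $b^r a b\wedge 1$ and $b a b^\ell\wedge 1$. $\mathcal{C}(\mathbf{M})$ and $\mathcal{N}(\mathbf{M})$ denote the lattices, under inclusion, of convex subalgebras and of convex normal subalgebras of $\mathbf{M}$, respectively. $\mathrm{N}_{\mathbf{L}}(S)$ is the smallest convex normal subalgebra of $\mathbf{L}$ containing $S$. The convex closure of $K\subseteq L$ in $\mathbf{L}$ is $\{a\in L: c\le a\le d\text{ for some }c,d\in K\}$. *)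

(* Defs.v *)
From HB Require Import structures.
From mathcomp Require Import all_boot all_order.
From mathcomp Require Import boolp classical_sets.

Set Implicit Arguments.
Unset Strict Implicit.
Unset Printing Implicit Defensive.

Import Order.TTheory.

Local Open Scope group_scope.
Local Open Scope order_scope.

HB.mixin Record Lattice_Monoid_isLPregroup (d : Order.disp_t) (L : Type)
    of Order.Lattice d L & Monoid L := {
  ladj : L -> L;
  radj : L -> L;
  lpg_mul_le2l : forall a x y : L, x <= y -> a * x <= a * y;
  lpg_mul_le2r : forall a x y : L, x <= y -> x * a <= y * a;
  ladj_mul_le1 : forall a : L, ladj a * a <= (1 : L);
  mul_ladj_ge1 : forall a : L, (1 : L) <= a * ladj a;
  mul_radj_le1 : forall a : L, a * radj a <= (1 : L);
  radj_mul_ge1 : forall a : L, (1 : L) <= radj a * a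
}.

#[short(type="lpregroupType")]
HB.structure Definition LPregroup (d : Order.disp_t) :=
  { L of Lattice_Monoid_isLPregroup d L & Order.Lattice d L & Monoid L }.

Arguments lpg_mul_le2l {d s} a [x y].
Arguments lpg_mul_le2r {d s} a [x y].

Section LPregroupTheory.
Context {d : Order.disp_t} {L : lpregroupType d}.
Implicit Types a b c x y z : L.

Lemma le_ladj a z : (z <= ladj a) = (z * a <= 1).
Proof.
apply/idP/idP => h; first exact: le_trans (lpg_mul_le2r a h) (ladj_mul_le1 a).
have := lpg_mul_le2l z (mul_ladj_ge1 a); rewrite mulg1 mulgA => /le_trans; apply.
by have := lpg_mul_le2r (ladj a) h; rewrite mul1g.
Qed.

Lemma ladj_le a z : (ladj a <= z) = (1 <= a * z).
Proof.
apply/idP/idP => h; first exact: le_trans (mul_ladj_ge1 a) (lpg_mul_le2l a h).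
have := lpg_mul_le2l (ladj a) h; rewrite mulg1 mulgA => /le_trans; apply.
by have := lpg_mul_le2r z (ladj_mul_le1 a); rewrite mul1g.
Qed.

Lemma le_radj a z : (z <= radj a) = (a * z <= 1).
Proof.
apply/idP/idP => h; first exact: le_trans (lpg_mul_le2l a h) (mul_radj_le1 a).
have := lpg_mul_le2r z (radj_mul_ge1 a); rewrite mul1g -mulgA => /le_trans.
by apply; have := lpg_mul_le2l (radj a) h; rewrite mulg1.
Qed.

Lemma radj_le a z : (radj a <= z) = (1 <= z * a).
Proof.
apply/idP/idP => h; first exact: le_trans (radj_mul_ge1 a) (lpg_mul_le2r a h).
have := lpg_mul_le2r (radj a) h; rewrite mul1g -mulgA => /le_trans; apply.
by have := lpg_mul_le2l z (mul_radj_le1 a); rewrite mulg1.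
Qed.

Lemma ladj_unique a b : b * a <= 1 -> 1 <= a * b -> ladj a = b.
Proof. by rewrite -le_ladj -ladj_le => h1 h2; apply: le_anti; rewrite h1 h2. Qed.

Lemma radj_unique a b : a * b <= 1 -> 1 <= b * a -> radj a = b.
Proof. by rewrite -le_radj -radj_le => h1 h2; apply: le_anti; rewrite h1 h2. Qed.

Lemma ladjK : cancel (@ladj d L) (@radj d L).
Proof. by move=> a; apply: radj_unique; [exact: ladj_mul_le1|exact: mul_ladj_ge1]. Qed.

Lemma radjK : cancel (@radj d L) (@ladj d L).
Proof. by move=> a; apply: ladj_unique; [exact: mul_radj_le1|exact: radj_mul_ge1]. Qed.

Lemma ladj_anti a b : a <= b -> ladj b <= ladj a.
Proof. by move=> ab; rewrite le_ladj (le_trans (lpg_mul_le2l _ ab)) ?ladj_mul_le1. Qed.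

Lemma radj_anti a b : a <= b -> radj b <= radj a.
Proof. by move=> ab; rewrite le_radj (le_trans (lpg_mul_le2r _ ab)) ?mul_radj_le1. Qed.

Lemma ladj1 : ladj (1 : L) = 1.
Proof. by apply: ladj_unique; rewrite mulg1. Qed.

Lemma radj1 : radj (1 : L) = 1.
Proof. by apply: radj_unique; rewrite mulg1. Qed.

Lemma ladjM a b : ladj (a * b) = ladj b * ladj a.
Proof.
apply: ladj_unique; rewrite mulgA.
  rewrite -[_ * a]mulgA.
  apply: le_trans (ladj_mul_le1 b); apply: lpg_mul_le2r.
  by have := lpg_mul_le2l (ladj b) (ladj_mul_le1 a); rewrite mulg1.
rewrite -[_ * ladj b]mulgA.
apply: le_trans (mul_ladj_ge1 a) _; apply: lpg_mul_le2r.
by have := lpg_mul_le2l a (mul_ladj_ge1 b); rewrite mulg1.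
Qed.

Lemma radjM a b : radj (a * b) = radj b * radj a.
Proof. by rewrite -[a in LHS]radjK -[b in LHS]radjK -ladjM ladjK. Qed.

Lemma ladjI a b : ladj (a `&` b) = ladj a `|` ladj b.
Proof.
have E x y : (ladj x <= y) = (radj y <= x) by rewrite ladj_le radj_le.
by apply/eqP; rewrite eq_le E lexI -!E leUl leUr leUx !ladj_anti ?leIl ?leIr.
Qed.

Lemma ladjU a b : ladj (a `|` b) = ladj a `&` ladj b.
Proof.
have E x y : (x <= ladj y) = (y <= radj x) by rewrite le_ladj le_radj.
by apply/eqP; rewrite eq_le E leUx -!E leIl leIr lexI !ladj_anti ?leUl ?leUr.
Qed.

Lemma radjI a b : radj (a `&` b) = radj a `|` radj b.
Proof. by rewrite -[a in LHS]radjK -[b in LHS]radjK -ladjU ladjK. Qed.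

Lemma radjU a b : radj (a `|` b) = radj a `&` radj b.
Proof. by rewrite -[a in LHS]radjK -[b in LHS]radjK -ladjI ladjK. Qed.

End LPregroupTheory.

Definition periodic (n : nat) (d : Order.disp_t) (L : lpregroupType d) : Prop :=
  forall x : L, iter n ladj x = iter n radj x.

Definition ladj_shift (d : Order.disp_t) (L : lpregroupType d) (k : nat) (x : L) : L :=
  iter k.*2 ladj x.

(* There is no top element to use as the empty meet: the default value [x] of
   the iterated meet is its term of index 0, so this is
   [x /\ x^[1] /\ ... /\ x^[n-1]] for [0 < n]. *)
Definition sigma (d : Order.disp_t) (L : lpregroupType d) (n : nat) (x : L) : L :=
  \big[Order.meet/x]_(1 <= k < n) ladj_shift k x.

Section GroupSkeleton.
Context {d : Order.disp_t} (L : lpregroupType d).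

Definition in_skeleton : pred L := fun a => ladj a == radj a.

Record skeleton : Type := Skeleton { skeleton_val : L; _ : in_skeleton skeleton_val }.

HB.instance Definition _ := [isSub for skeleton_val].
HB.instance Definition _ := [Choice of skeleton by <:].

Fact in_skeleton_meet :
  {in in_skeleton &, forall a b, a `&` b \in in_skeleton}.
Proof.
move=> a b; rewrite !unfold_in => /eqP ha /eqP hb.
by rewrite ladjI radjI ha hb.
Qed.

Fact in_skeleton_join :
  {in in_skeleton &, forall a b, a `|` b \in in_skeleton}.
Proof.
move=> a b; rewrite !unfold_in => /eqP ha /eqP hb.
by rewrite ladjU radjU ha hb.
Qed.

HB.instance Definition _ := Order.SubChoice_isSubLattice.Build d L in_skeleton d
  skeleton in_skeleton_meet in_skeleton_join.

Fact in_skeleton_monoid : monoid_closed in_skeleton.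
Proof.
split=> [|a b]; rewrite !unfold_in ?ladj1 ?radj1 //.
by move=> /eqP ha /eqP hb; rewrite ladjM radjM ha hb.
Qed.

HB.instance Definition _ :=
  SubChoice_isSubMonoid.Build L in_skeleton skeleton in_skeleton_monoid.

Fact in_skeleton_ladj (a : skeleton) : in_skeleton (ladj (val a)).
Proof.
by have /eqP h := valP a; rewrite /in_skeleton ladjK h radjK.
Qed.

Fact in_skeleton_radj (a : skeleton) : in_skeleton (radj (val a)).
Proof. by have /eqP <- := valP a; exact: in_skeleton_ladj. Qed.

Definition skeleton_ladj (a : skeleton) : skeleton := Skeleton (in_skeleton_ladj a).
Definition skeleton_radj (a : skeleton) : skeleton := Skeleton (in_skeleton_radj a).

Fact skeleton_mul_le2l (a x y : skeleton) : x <= y -> a * x <= a * y.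
Proof. exact: (@lpg_mul_le2l d L (val a)). Qed.
Fact skeleton_mul_le2r (a x y : skeleton) : x <= y -> x * a <= y * a.
Proof. exact: (@lpg_mul_le2r d L (val a)). Qed.
Fact skeleton_ladj_mul_le1 (a : skeleton) : skeleton_ladj a * a <= (1 : skeleton).
Proof. exact: (ladj_mul_le1 (val a)). Qed.
Fact skeleton_mul_ladj_ge1 (a : skeleton) : (1 : skeleton) <= a * skeleton_ladj a.
Proof. exact: (mul_ladj_ge1 (val a)). Qed.
Fact skeleton_mul_radj_le1 (a : skeleton) : a * skeleton_radj a <= (1 : skeleton).
Proof. exact: (mul_radj_le1 (val a)). Qed.
Fact skeleton_radj_mul_ge1 (a : skeleton) : (1 : skeleton) <= skeleton_radj a * a.
Proof. exact: (radj_mul_ge1 (val a)). Qed.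

HB.instance Definition _ := Lattice_Monoid_isLPregroup.Build d skeleton
  skeleton_mul_le2l skeleton_mul_le2r
  skeleton_ladj_mul_le1 skeleton_mul_ladj_ge1
  skeleton_mul_radj_le1 skeleton_radj_mul_ge1.

End GroupSkeleton.

Lemma val_ladj (d : Order.disp_t) (L : lpregroupType d) (a : skeleton L) :
  val (ladj a) = ladj (val a).
Proof. by []. Qed.

Lemma val_radj (d : Order.disp_t) (L : lpregroupType d) (a : skeleton L) :
  val (radj a) = radj (val a).
Proof. by []. Qed.

Section ConvexSubalgebras.
Local Open Scope classical_set_scope.
Context {d : Order.disp_t} {M : lpregroupType d}.
Implicit Types H K S : set M.

Record subalgebra H : Prop := Subalgebra {
  subalg_meet : forall a b, H a -> H b -> H (Order.meet a b);
  subalg_join : forall a b, H a -> H b -> H (Order.join a b);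
  subalg_mul : forall a b, H a -> H b -> H (a * b)%g;
  subalg_one : H 1%g;
  subalg_ladj : forall a, H a -> H (ladj a);
  subalg_radj : forall a, H a -> H (radj a)
}.

Definition order_convex H : Prop :=
  forall a b x : M, H a -> H b -> (a <= x)%O -> (x <= b)%O -> H x.

Definition lpg_normal H : Prop := forall a b : M, H a ->
  H (Order.meet (radj b * a * b)%g 1%g) /\ H (Order.meet (b * a * ladj b)%g 1%g).

Definition convex_subalgebra H : Prop := subalgebra H /\ order_convex H.

Definition convex_normal_subalgebra H : Prop := convex_subalgebra H /\ lpg_normal H.

Definition convex_closure S : set M :=
  [set a | exists c e, [/\ S c, S e, (c <= a)%O & (a <= e)%O]].

Lemma subset_convex_closure S : S `<=` convex_closure S.
Proof. by move=> a Sa; exists a, a; split. Qed.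

Lemma convex_subalgebra_bigcap (F : set (set M)) :
  (forall H, F H -> convex_subalgebra H) -> convex_subalgebra (\bigcap_(H in F) H).
Proof.
move=> FP; split; last first.
  move=> a b x Ha Hb ax xb H FH; have [_ Hc] := FP H FH.
  exact: (Hc a b x (Ha H FH) (Hb H FH) ax xb).
by split=> [a b Ha Hb|a b Ha Hb|a b Ha Hb||a Ha|a Ha] H FH;
  have [[HI HU HM H1 Hl Hr] _] := FP H FH => //;
  [exact: HI (Ha H FH) (Hb H FH)|exact: HU (Ha H FH) (Hb H FH)
  |exact: HM (Ha H FH) (Hb H FH)|exact: Hl (Ha H FH)|exact: Hr (Ha H FH)].
Qed.

Lemma convex_normal_subalgebra_bigcap (F : set (set M)) :
  (forall H, F H -> convex_normal_subalgebra H) ->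
  convex_normal_subalgebra (\bigcap_(H in F) H).
Proof.
move=> FP; split; first by apply: convex_subalgebra_bigcap => H /FP[].
by move=> a b Ha; split=> H FH; have [_ Hn] := FP H FH;
  have [] := Hn a b (Ha H FH).
Qed.

Lemma convex_subalgebra_smallest S :
  convex_subalgebra (smallest convex_subalgebra S).
Proof. by apply: convex_subalgebra_bigcap => H []. Qed.

Lemma convex_normal_subalgebra_smallest S :
  convex_normal_subalgebra (smallest convex_normal_subalgebra S).
Proof. by apply: convex_normal_subalgebra_bigcap => H []. Qed.

Lemma convex_subalgebraI H K :
  convex_subalgebra H -> convex_subalgebra K -> convex_subalgebra (H `&` K).
Proof.
move=> hH hK; have -> : H `&` K = \bigcap_(X in [set H; K]) X.
  by rewrite bigcap_setU1 bigcap_set1.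
by apply: convex_subalgebra_bigcap => X [->|->].
Qed.

Lemma convex_normal_subalgebraI H K :
  convex_normal_subalgebra H -> convex_normal_subalgebra K ->
  convex_normal_subalgebra (H `&` K).
Proof.
move=> hH hK; have -> : H `&` K = \bigcap_(X in [set H; K]) X.
  by rewrite bigcap_setU1 bigcap_set1.
by apply: convex_normal_subalgebra_bigcap => X [->|->].
Qed.

End ConvexSubalgebras.

Section Lattices.
Local Open Scope classical_set_scope.
Context {d : Order.disp_t} (M : lpregroupType d).

Record csub : Type :=
  Csub { csub_set :> set M; _ : `[< convex_subalgebra csub_set >] }.

HB.instance Definition _ := [isSub for csub_set].
HB.instance Definition _ := [Choice of csub by <:].
HB.instance Definition _ := [SubChoice_isSubPOrder of csub by <: with set_display].

Record ncsub : Type :=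
  Ncsub { ncsub_set :> set M; _ : `[< convex_normal_subalgebra ncsub_set >] }.

HB.instance Definition _ := [isSub for ncsub_set].
HB.instance Definition _ := [Choice of ncsub by <:].
HB.instance Definition _ := [SubChoice_isSubPOrder of ncsub by <: with set_display].

Definition mk_csub (H : set M) (hH : convex_subalgebra H) : csub :=
  Csub (asboolT hH).
Definition mk_ncsub (H : set M) (hH : convex_normal_subalgebra H) : ncsub :=
  Ncsub (asboolT hH).

Lemma csubP (H : csub) : convex_subalgebra H.
Proof. by case: H => H /= /asboolP. Qed.

Lemma ncsubP (H : ncsub) : convex_normal_subalgebra H.
Proof. by case: H => H /= /asboolP. Qed.

Definition csub_gen (S : set M) : csub := mk_csub (convex_subalgebra_smallest S).
Definition ncsub_gen (S : set M) : ncsub :=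
  mk_ncsub (convex_normal_subalgebra_smallest S).

Definition csub_meet (H K : csub) : csub :=
  mk_csub (convex_subalgebraI (csubP H) (csubP K)).
Definition csub_join (H K : csub) : csub := csub_gen (H `|` K).

Definition ncsub_meet (H K : ncsub) : ncsub :=
  mk_ncsub (convex_normal_subalgebraI (ncsubP H) (ncsubP K)).
Definition ncsub_join (H K : ncsub) : ncsub := ncsub_gen (H `|` K).

Fact csub_meetP (X H K : csub) :
  (X <= csub_meet H K)%O = ((X <= H)%O && (X <= K)%O).
Proof. by rewrite !leEsub /= -lexI. Qed.

Fact csub_joinP (H K X : csub) :
  (csub_join H K <= X)%O = ((H <= X)%O && (K <= X)%O).
Proof.
rewrite !leEsub /= -leUx joinEset; apply/idP/idP => /subsetPset h; apply/subsetPset.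
  exact: subset_trans (@sub_gen_smallest _ _ _) h.
by apply: smallest_sub => //; exact: csubP.
Qed.

Fact ncsub_meetP (X H K : ncsub) :
  (X <= ncsub_meet H K)%O = ((X <= H)%O && (X <= K)%O).
Proof. by rewrite !leEsub /= -lexI. Qed.

Fact ncsub_joinP (H K X : ncsub) :
  (ncsub_join H K <= X)%O = ((H <= X)%O && (K <= X)%O).
Proof.
rewrite !leEsub /= -leUx joinEset; apply/idP/idP => /subsetPset h; apply/subsetPset.
  exact: subset_trans (@sub_gen_smallest _ _ _) h.
by apply: smallest_sub => //; exact: ncsubP.
Qed.

HB.instance Definition _ := Order.POrder_MeetJoin_isLattice.Build
  set_display csub csub_meetP csub_joinP.
HB.instance Definition _ := Order.POrder_MeetJoin_isLattice.Build
  set_display ncsub ncsub_meetP ncsub_joinP.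

Lemma le_csub (H K : csub) : reflect (H `<=` K) (H <= K)%O.
Proof. by rewrite leEsub; exact: subsetPset. Qed.

Lemma le_ncsub (H K : ncsub) : reflect (H `<=` K) (H <= K)%O.
Proof. by rewrite leEsub; exact: subsetPset. Qed.

Definition csub_of_ncsub (H : ncsub) : csub := mk_csub (ncsubP H).1.

End Lattices.

Section Maps.
Local Open Scope classical_set_scope.
Context {d : Order.disp_t} {L : lpregroupType d}.

(* As a subset of [skeleton L], the trace [H `&` L_g] is the preimage of [H]
   under the inclusion of [skeleton L] into [L]. *)
Definition skeleton_trace (H : set L) : set (skeleton L) := val @^-1` H.

Lemma convex_subalgebra_trace (H : set L) :
  convex_subalgebra H -> convex_subalgebra (skeleton_trace H).
Proof.
case=> -[HI HU HM H1 Hl Hr] Hc; split; last first.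
  by move=> a b x Ha Hb ax xb; exact: Hc Ha Hb ax xb.
split=> [a b Ha Hb|a b Ha Hb|a b Ha Hb||a Ha|a Ha];
  [exact: HI|exact: HU|exact: HM|exact: H1|exact: Hl|exact: Hr].
Qed.

Lemma convex_normal_subalgebra_trace (H : set L) :
  convex_normal_subalgebra H -> convex_normal_subalgebra (skeleton_trace H).
Proof.
move=> [Hcs Hn]; split; first exact: convex_subalgebra_trace.
by move=> a b Ha; exact: (Hn (val a) (val b) Ha).
Qed.

Lemma convex_subalgebra_closure (K : set (skeleton L)) :
  convex_subalgebra K -> convex_subalgebra (convex_closure (val @` K)).
Proof.
case=> -[KI KU KM K1 Kl Kr] _; split; last first.
  move=> a b x [c [_ [Kc _ ca _]]] [_ [e [_ Ke _ be]]] ax xb.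
  exists c, e; split=> //; [exact: le_trans ca ax|exact: le_trans xb be].
split.
- move=> a b [_ [_ [[c Kc <-] [e Ke <-] ca ae]]] [_ [_ [[c' Kc' <-] [e' Ke' <-] cb be]]].
  exists (val (c `&` c')%O), (val (e `&` e')%O); split.
  + by exists (c `&` c')%O => //; exact: KI.
  + by exists (e `&` e')%O => //; exact: KI.
  + exact: leI2 ca cb.
  + exact: leI2 ae be.
- move=> a b [_ [_ [[c Kc <-] [e Ke <-] ca ae]]] [_ [_ [[c' Kc' <-] [e' Ke' <-] cb be]]].
  exists (val (c `|` c')%O), (val (e `|` e')%O); split.
  + by exists (c `|` c')%O => //; exact: KU.
  + by exists (e `|` e')%O => //; exact: KU.
  + exact: leU2 ca cb.
  + exact: leU2 ae be.
- move=> a b [_ [_ [[c Kc <-] [e Ke <-] ca ae]]] [_ [_ [[c' Kc' <-] [e' Ke' <-] cb be]]].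
  exists (val (c * c')%g), (val (e * e')%g); split.
  + by exists (c * c')%g => //; exact: KM.
  + by exists (e * e')%g => //; exact: KM.
  + exact: le_trans (lpg_mul_le2l _ cb) (lpg_mul_le2r _ ca).
  + exact: le_trans (lpg_mul_le2l _ be) (lpg_mul_le2r _ ae).
- by apply: subset_convex_closure; exists 1%g.
- move=> a [_ [_ [[c Kc <-] [e Ke <-] ca ae]]].
  exists (val (ladj e)), (val (ladj c)); split.
  + by exists (ladj e) => //; exact: Kl.
  + by exists (ladj c) => //; exact: Kl.
  + exact: ladj_anti ae.
  + exact: ladj_anti ca.
- move=> a [_ [_ [[c Kc <-] [e Ke <-] ca ae]]].
  exists (val (radj e)), (val (radj c)); split.
  + by exists (radj e) => //; exact: Kr.
  + by exists (radj c) => //; exact: Kr.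
  + exact: radj_anti ae.
  + exact: radj_anti ca.
Qed.

Definition csub_trace (H : csub L) : csub (skeleton L) :=
  mk_csub (convex_subalgebra_trace (csubP H)).

Definition csub_closure (K : csub (skeleton L)) : csub L :=
  mk_csub (convex_subalgebra_closure (csubP K)).

Definition ncsub_trace (H : ncsub L) : ncsub (skeleton L) :=
  mk_ncsub (convex_normal_subalgebra_trace (ncsubP H)).

Definition ncsub_ext (G : ncsub (skeleton L)) : ncsub L := ncsub_gen (val @` G).

End Maps.

Definition lattice_morphism (d d' : Order.disp_t) (A : latticeType d)
    (B : latticeType d') (f : A -> B) : Prop :=
  Order.meet_morphism f /\ Order.join_morphism f.

Definition inverse_lattice_isos (d d' : Order.disp_t) (A : latticeType d)
    (B : latticeType d') (f : A -> B) (g : B -> A) : Prop :=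
  [/\ cancel f g, cancel g f, lattice_morphism f & lattice_morphism g].

(* Main.v *)
Require Import Defs.
From mathcomp Require Import all_boot all_order.
From mathcomp Require Import boolp classical_sets.

(** Periodicity makes [sigma n x] the meet of the whole orbit of [x] under the
    automorphism [ladj \o ladj].  Being invariant under that automorphism, it
    lies in the group skeleton, and it is below [x]; a convex subalgebra [H]
    containing [x] contains it too.  Dually, [radj (sigma n (ladj x))] is an
    element of the skeleton and of [H] above [x].  So every element of [H] lies
    between two elements of the trace of [H] ([csub_traceK]), while convexity in
    the skeleton gives the opposite cancellation ([csub_closureK]).  Both maps
    are monotone, hence they are lattice isomorphisms.

    The centrality of the powers [sigma n x ^+ n] makes every convex subalgebra
    of [L] normal ([convex_subalgebra_normal]): the element
    [sigma n (a `&` 1) ^+ n] of the subalgebra is below [a] and [1] and, being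
    central, below its own conjugates, so it bounds those of [a] from below.  Consequently
    the convex closure of a normal [G] is already normal, and it is the convex
    normal subalgebra generated by [G]; the isomorphism for normal subalgebras
    is the restriction of the one for convex subalgebras. *)

Set Implicit Arguments.
Unset Strict Implicit.
Unset Printing Implicit Defensive.

Import Order.TTheory.

Local Open Scope group_scope.
Local Open Scope order_scope.

Lemma monotone_bij_lattice_morphism (d d' : Order.disp_t) (A : latticeType d)
    (B : latticeType d') (f : A -> B) (g : B -> A) :
  {homo f : x y / x <= y} -> {homo g : x y / x <= y} ->
  cancel f g -> cancel g f -> lattice_morphism f.
Proof.
move=> fh gh fK gK.
have le_gf x y : (x <= g y) = (f x <= y).
  by apply/idP/idP => [/fh|/gh]; rewrite ?gK ?fK.
have ge_gf x y : (g y <= x) = (y <= f x).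
  by apply/idP/idP => [/fh|/gh]; rewrite ?gK ?fK.
split=> x y; apply: le_anti; apply/andP; split.
- by rewrite lexI !fh ?leIl ?leIr.
- by rewrite -ge_gf lexI !ge_gf leIl leIr.
- by rewrite -le_gf leUx !le_gf leUl leUr.
- by rewrite leUx !fh ?leUl ?leUr.
Qed.

Lemma monotone_inverse_lattice_isos (d d' : Order.disp_t) (A : latticeType d)
    (B : latticeType d') (f : A -> B) (g : B -> A) :
  {homo f : x y / x <= y} -> {homo g : x y / x <= y} ->
  cancel f g -> cancel g f -> inverse_lattice_isos f g.
Proof.
by move=> fh gh fK gK; split=> //;
  [exact: monotone_bij_lattice_morphism gK|exact: monotone_bij_lattice_morphism fK].
Qed.

Section Sigma.
Context {d : Order.disp_t} {L : lpregroupType d}.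
Implicit Types (x z : L) (n k : nat).

Lemma le_sigma n x z : (0 < n)%N ->
  reflect (forall k, (k < n)%N -> z <= ladj_shift k x) (z <= sigma n x).
Proof.
move=> n_gt0.
have -> : (z <= sigma n x) =
    (z <= x) && all (fun k => z <= ladj_shift k x) (index_iota 1 n).
  rewrite /sigma; elim: (index_iota 1 n) => [|k s IHs]; first by rewrite big_nil andbT.
  by rewrite big_cons lexI IHs /= andbCA.
apply: (iffP andP) => [[zx /allP zs] [|k] kn //|h].
  by apply: zs; rewrite mem_index_iota.
split; first exact: (h 0%N).
by apply/allP=> k; rewrite mem_index_iota => /andP[_]; exact: h.
Qed.

Lemma sigma_le n x : (0 < n)%N -> sigma n x <= x.
Proof. by move=> n_gt0; apply: (le_sigma _ _ n_gt0 (lexx _) 0%N). Qed.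

Lemma le_ladj2 x z : (ladj (ladj x) <= ladj (ladj z)) = (x <= z).
Proof.
apply/idP/idP => h; last by do 2!apply: ladj_anti.
by rewrite -(ladjK x) -(ladjK z); apply: radj_anti;
  rewrite -(ladjK (ladj x)) -(ladjK (ladj z)); apply: radj_anti.
Qed.

Lemma ladj_shiftS k x : ladj_shift k.+1 x = ladj (ladj (ladj_shift k x)).
Proof. by []. Qed.

Lemma ladj_shift_period n x : periodic n L -> ladj_shift n x = x.
Proof.
move=> per; rewrite /ladj_shift -addnn iterD [iter n _ x]per.
by elim: n {per} x => // n IHn x; rewrite iterSr iterS radjK.
Qed.

(** Applying [ladj] twice is an automorphism that permutes cyclically the terms
    of the meet, so it fixes the meet; and [ladj (ladj s) = s] amounts to
    [ladj s = radj s]. *)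
Lemma sigma_skeleton n x : (0 < n)%N -> periodic n L ->
  in_skeleton (sigma n x).
Proof.
move=> n_gt0 per; set s := sigma n x.
have s_le k : (k < n)%N -> s <= ladj_shift k x by apply/le_sigma.
suff ss : ladj (ladj s) = s by rewrite /in_skeleton -{2}ss ladjK.
apply: le_anti; apply/andP; split.
  apply/le_sigma => // -[_|k kn]; last by rewrite ladj_shiftS le_ladj2 s_le // ltnW.
  (* The term of index 0 is also the term of index n, the shift of term n-1. *)
  rewrite -[X in ladj_shift 0 X](ladj_shift_period x per).
  rewrite [leRHS]/= -(prednK n_gt0) ladj_shiftS le_ladj2.
  by apply: s_le; rewrite ltn_predL.
rewrite -[X in X <= _]radjK -[radj s]radjK le_ladj2.
apply/le_sigma => // k kn; rewrite -le_ladj2 !radjK -ladj_shiftS.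
have [->|k1n] := eqVneq k.+1 n; last by apply: s_le; rewrite ltn_neqAle k1n.
by rewrite ladj_shift_period //; exact: sigma_le.
Qed.

Lemma subalgebra_sigma (H : set L) n x : subalgebra H -> H x -> H (sigma n x).
Proof.
move=> Hs Hx; rewrite /sigma; apply: big_ind => //; first exact: subalg_meet.
move=> k _; rewrite /ladj_shift; elim: (k.*2) => //= m; exact: subalg_ladj.
Qed.

Lemma subalgebra_exp (H : set L) n x : subalgebra H -> H x -> H (x ^+ n).
Proof.
move=> Hs Hx; elim: n => [|n IHn]; first exact: subalg_one.
by rewrite expgS; exact: subalg_mul.
Qed.

Lemma exp_le1 n x : x <= 1 -> x ^+ n <= 1.
Proof.
move=> x1; elim: n => // n IHn; rewrite expgS.
by apply: le_trans x1; have := lpg_mul_le2l x IHn; rewrite mulg1.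
Qed.

Lemma exp_le_base n x : (0 < n)%N -> x <= 1 -> x ^+ n <= x.
Proof.
case: n => // n _ x1; rewrite expgS.
by have := lpg_mul_le2l x (exp_le1 n x1); rewrite mulg1.
Qed.

(** For [c] central, [radj_mul_ge1] gives [c <= radj b * b * c = radj b * c * b],
    which is below [radj b * a * b] when [c <= a], and similarly on the other
    side.  Such a [c] in [H] is a power of [sigma n (a `&` 1)]. *)
Lemma convex_subalgebra_normal (H : set L) n : (0 < n)%N ->
  (forall x y : L, sigma n x ^+ n * y = y * sigma n x ^+ n) ->
  convex_subalgebra H -> lpg_normal H.
Proof.
move=> n_gt0 central [Hs Hc] a b Ha.
set s := sigma n (a `&` 1).
have s_le : s <= a `&` 1 by exact: sigma_le.
have s1 : s <= 1 by apply: le_trans s_le (leIr _ _).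
have Hsn : H (s ^+ n).
  apply: subalgebra_exp => //; apply: subalgebra_sigma => //.
  by apply: subalg_meet => //; exact: subalg_one.
have sna : s ^+ n <= a.
  exact: le_trans (exp_le_base n_gt0 s1) (le_trans s_le (leIl _ _)).
have H1 := subalg_one Hs.
split; apply: (Hc _ _ _ Hsn H1); rewrite ?leIr // lexI exp_le1 // andbT.
  apply: le_trans (lpg_mul_le2r b (lpg_mul_le2l (radj b) sna)).
  rewrite -mulgA central mulgA.
  by have := lpg_mul_le2r (s ^+ n) (radj_mul_ge1 b); rewrite mul1g.
apply: le_trans (lpg_mul_le2r (ladj b) (lpg_mul_le2l b sna)).
rewrite -central -mulgA.
by have := lpg_mul_le2l (s ^+ n) (mul_ladj_ge1 b); rewrite mulg1.
Qed.

End Sigma.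

Section Correspondence.
Context {d : Order.disp_t} {L : lpregroupType d}.

Lemma csub_trace_homo :
  {homo (@csub_trace d L) : H K / H <= K}.
Proof. by move=> H K /le_csub HK; apply/le_csub => a; exact: HK. Qed.

Lemma csub_closure_homo :
  {homo (@csub_closure d L) : G K / G <= K}.
Proof.
move=> G K /le_csub GK; apply/le_csub => a [_ [_ [[c Gc <-] [e Ge <-] ca ae]]].
by exists (val c), (val e); split=> //; [exists c|exists e] => //; exact: GK.
Qed.

Lemma csub_closureK : cancel (@csub_closure d L) (@csub_trace d L).
Proof.
move=> K; apply: val_inj; apply/seteqP; split=> a /=.
  move=> [_ [_ [[c Kc <-] [e Ke <-] ca ae]]].
  exact: (csubP K).2 Kc Ke ca ae.
by move=> Ka; apply: subset_convex_closure; exists a.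
Qed.

(** An element [a] lies between [sigma n a] and its dual, obtained by applying
    the antitone bijection [radj] to [sigma n (ladj a) <= ladj a]. *)
Lemma csub_traceK n : (0 < n)%N -> periodic n L ->
  cancel (@csub_trace d L) (@csub_closure d L).
Proof.
move=> n_gt0 per H; have [Hs Hc] := csubP H.
apply: val_inj; apply/seteqP; split=> a /=.
  by move=> [_ [_ [[c Hc' <-] [e He <-] ca ae]]]; exact: Hc Hc' He ca ae.
move=> Ha; have sk x := sigma_skeleton x n_gt0 per.
exists (sigma n a), (radj (sigma n (ladj a))); split.
- by exists (Skeleton (sk a)) => //; exact: subalgebra_sigma.
- exists (radj (Skeleton (sk (ladj a)))) => //.
  exact: (subalg_radj Hs (subalgebra_sigma n Hs (subalg_ladj Hs Ha))).
- exact: sigma_le.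
- by rewrite -{1}(ladjK a); apply: radj_anti; exact: sigma_le.
Qed.

Lemma csub_of_ncsub_inj : injective (@csub_of_ncsub d L).
Proof. by move=> H K /(congr1 val) HK; exact: val_inj. Qed.

Lemma csub_of_ncsub_trace (H : ncsub L) :
  csub_of_ncsub (ncsub_trace H) = csub_trace (csub_of_ncsub H).
Proof. exact: val_inj. Qed.

(** The convex closure of [G] is normal like any convex subalgebra, so passing to
    the generated convex normal subalgebra adds nothing more. *)
Lemma csub_of_ncsub_ext n (G : ncsub (skeleton L)) : (0 < n)%N ->
  (forall x y : L, sigma n x ^+ n * y = y * sigma n x ^+ n) ->
  csub_of_ncsub (ncsub_ext G) = csub_closure (csub_of_ncsub G).
Proof.
move=> n_gt0 central; apply: val_inj => /=; apply/seteqP; split.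
  apply: smallest_sub; last exact: subset_convex_closure.
  split; first exact: (csubP (csub_closure (csub_of_ncsub G))).
  exact: (convex_subalgebra_normal n_gt0 central
           (csubP (csub_closure (csub_of_ncsub G)))).
move=> a [c [e [Gc Ge ca ae]]] N [Ncn GN].
exact: (Ncn.1.2 _ _ _ (GN _ Gc) (GN _ Ge) ca ae).
Qed.

End Correspondence.

Theorem proposition2p21 (d : Order.disp_t) (L : lpregroupType d) (n : nat)
    (n_gt0 : (0 < n)%N)
    (L_periodic : periodic n L)
    (L_sigma : forall x y : L, (sigma n x ^+ n * y = y * sigma n x ^+ n)%g) :
  [/\ inverse_lattice_isos
        (@ncsub_trace d L : ncsub L -> ncsub (skeleton L))
        (@ncsub_ext d L : ncsub (skeleton L) -> ncsub L),
      inverse_lattice_isos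
        (@csub_trace d L : csub L -> csub (skeleton L))
        (@csub_closure d L : csub (skeleton L) -> csub L),
      forall H : ncsub L,
        csub_of_ncsub (ncsub_trace H) = csub_trace (csub_of_ncsub H) &
      forall G : ncsub (skeleton L),
        csub_of_ncsub (ncsub_ext G) = csub_closure (csub_of_ncsub G)].
Proof.
have traceK := csub_traceK n_gt0 L_periodic.
have extE G := csub_of_ncsub_ext G n_gt0 L_sigma.
split=> //; last exact: csub_of_ncsub_trace.
  apply: monotone_inverse_lattice_isos.
  - by move=> H K /le_ncsub HK; apply/le_ncsub => a; exact: HK.
  - move=> G K /le_ncsub GK; apply/le_ncsub.
    have /le_csub : csub_of_ncsub (ncsub_ext G) <= csub_of_ncsub (ncsub_ext K).
      by rewrite !extE; apply: csub_closure_homo; apply/le_csub.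
    exact.
  - by move=> H; apply: csub_of_ncsub_inj; rewrite extE csub_of_ncsub_trace traceK.
  - move=> G; apply: csub_of_ncsub_inj.
    by rewrite csub_of_ncsub_trace extE csub_closureK.
apply: monotone_inverse_lattice_isos => //.
- exact: csub_trace_homo.
- exact: csub_closure_homo.
- exact: csub_closureK.
Qed.
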